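(* Let $M$ be a matroid with ground set $E$ and let $S\subseteq E$. Every $\mathbf{1}_S$-monotone path on the base polytope $B_M$ is coherent, where $\mathbf{1}_S(x)=\sum_{i\in S}x_i$.
   Context: $B_M=\mathrm{conv}\{e_B: B\text{ a basis of }M\}\subset\mathbb{R}^E$, $e_B=\sum_{b\in B}e_b$. For a polytope $P$ and a linear $c$ non-constant on $P$ (monotone paths are only defined in this case), a $c$-monotone path is a sequence of vertices $v_0,\dots,v_m$ with $v_0$ in the face minimizing $c$, $v_m$ in the face maximizing $c$, each $[v_{i-1},v_i]$ an edge and $\langle c,v_{i-1}\rangle<\langle c,v_i\rangle$. It is coherent if there is $w$ such that, with $\pi(x)=(\langle c,x\rangle,\langle w,x\rangle)$, the upper boundary of $\pi(P)$ (points $(s,t)\in\pi(P)$ with $(s,t+\epsilon)\notin\pi(P)$ for all $\epsilon>0$) is the union of the segments $\pi([v_{i-1},v_i])$ and $\{x\in P:\pi(x)\in\pi([v_{i-1},v_i])\}=[v_{i-1},v_i]$ for every $i$. *)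

(* Defs.v *)
From HB Require Import structures.
From mathcomp Require Import all_boot all_order all_algebra.
From mathcomp Require Import boolp classical_sets reals.

Set Implicit Arguments.
Unset Strict Implicit.
Unset Printing Implicit Defensive.

Import Order.TTheory GRing.Theory Num.Theory.

Local Open Scope classical_set_scope.
Local Open Scope ring_scope.

Record matroid (E : finType) := Matroid {
  bases : {set {set E}};
  bases_nonempty : exists B, B \in bases;
  basis_exchange : forall A B, A \in bases -> B \in bases ->
    forall a, a \in A :\: B ->
      exists2 b, b \in B :\: A & b |: (A :\ a) \in bases
}.

(* R^E; the regular module R^o provides the scaling operation. *)
Definition vec (R : realType) (E : finType) := {ffun E -> R^o}.

Definition dot (R : realType) (E : finType) (c x : vec R E) : R :=
  \sum_(i : E) c i * x i.

Definition unit_vec (R : realType) (E : finType) (b : E) : vec R E :=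
  [ffun i => (i == b)%:R].

(* For a basis B this is the point e_B; for a subset S it is also the vector
   representing the functional 1_S, see [dot_indic]. *)
Definition indic (R : realType) (E : finType) (A : {set E}) : vec R E :=
  \sum_(b in A) unit_vec R b.

Lemma indicE (R : realType) (E : finType) (A : {set E}) (i : E) :
  indic R A i = (i \in A)%:R.
Proof.
rewrite /indic sum_ffunE; case: (boolP (i \in A)) => iA.
  rewrite (bigD1 i) //= ffunE eqxx big1 ?addr0 // => j /andP[_ ji].
  by rewrite ffunE eq_sym (negbTE ji).
by rewrite big1 // => j jA; rewrite ffunE; case: eqP iA => // ->; rewrite jA.
Qed.

Lemma dot_indic (R : realType) (E : finType) (S : {set E}) (x : vec R E) :
  dot (indic R S) x = \sum_(i in S) x i.
Proof.
rewrite /dot [RHS]big_mkcond; apply: eq_bigr => i _; rewrite indicE.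
by case: (i \in S); rewrite ?mul1r ?mul0r.
Qed.

Definition conv_hull (R : realType) (E : finType) (A : set (vec R E)) :
    set (vec R E) :=
  [set x | exists (n : nat) (t : 'I_n -> R) (p : 'I_n -> vec R E),
    [/\ forall i, 0 <= t i, \sum_i t i = 1, forall i, A (p i)
      & x = \sum_i t i *: p i]].

Definition seg (R : realType) (E : finType) (u v : vec R E) : set (vec R E) :=
  [set x | exists t : R, 0 <= t <= 1 /\ x = (1 - t) *: u + t *: v].

Definition base_polytope (R : realType) (E : finType) (M : matroid E) :
    set (vec R E) :=
  conv_hull [set x | exists2 B, B \in bases M & x = indic R B].

Arguments base_polytope R {E} M _.

Definition max_face (R : realType) (E : finType) (P : set (vec R E))
    (c : vec R E) : set (vec R E) :=
  [set x | P x /\ forall y, P y -> dot c y <= dot c x].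

Definition min_face (R : realType) (E : finType) (P : set (vec R E))
    (c : vec R E) : set (vec R E) :=
  [set x | P x /\ forall y, P y -> dot c x <= dot c y].

(* Every nonempty face of a polytope P is [max_face P l] for some l, so
   vertices and edges are the faces of this form of dimension 0 and 1. *)
Definition is_vertex (R : realType) (E : finType) (P : set (vec R E))
    (v : vec R E) : Prop :=
  exists l : vec R E, max_face P l = [set v].

Definition is_edge (R : realType) (E : finType) (P : set (vec R E))
    (u v : vec R E) : Prop :=
  u <> v /\ exists l : vec R E, max_face P l = seg u v.

Definition nonconstant_on (R : realType) (E : finType) (P : set (vec R E))
    (c : vec R E) : Prop :=
  exists x y, [/\ P x, P y & dot c x <> dot c y].

(* For i : 'I_m, the ordinals [inord i] and [inord i.+1] of 'I_m.+1 have values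
   i and i + 1, so the i-th step goes from v_i to v_(i+1). *)
Definition step_src (R : realType) (E : finType) (m : nat)
    (v : 'I_m.+1 -> vec R E) (i : 'I_m) : vec R E := v (inord i).

Definition step_tgt (R : realType) (E : finType) (m : nat)
    (v : 'I_m.+1 -> vec R E) (i : 'I_m) : vec R E := v (inord i.+1).

Definition step_seg (R : realType) (E : finType) (m : nat)
    (v : 'I_m.+1 -> vec R E) (i : 'I_m) : set (vec R E) :=
  seg (step_src v i) (step_tgt v i).

(* Monotone paths are only defined for functionals that are not constant on P:
   otherwise a single vertex (m = 0) would satisfy the remaining clauses. *)
Definition monotone_path (R : realType) (E : finType) (P : set (vec R E))
    (c : vec R E) (m : nat) (v : 'I_m.+1 -> vec R E) : Prop :=
  nonconstant_on P c /\
  [/\ forall j, is_vertex P (v j),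
      min_face P c (v ord0),
      max_face P c (v ord_max),
      forall i : 'I_m, is_edge P (step_src v i) (step_tgt v i)
    & forall i : 'I_m, dot c (step_src v i) < dot c (step_tgt v i)].

Definition proj (R : realType) (E : finType) (c w x : vec R E) : R * R :=
  (dot c x, dot w x).

Definition upper_boundary (R : realType) (Q : set (R * R)) : set (R * R) :=
  [set p | Q p /\ forall eps : R, 0 < eps -> ~ Q (p.1, p.2 + eps)].

Definition coherent (R : realType) (E : finType) (P : set (vec R E))
    (c : vec R E) (m : nat) (v : 'I_m.+1 -> vec R E) : Prop :=
  exists w : vec R E,
    upper_boundary (proj c w @` P)
      = \bigcup_(i in [set: 'I_m]) (proj c w @` step_seg v i) /\
    forall i : 'I_m,
      [set x | P x /\ (proj c w @` step_seg v i) (proj c w x)] = step_seg v i.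

(* Main.v *)
(* Consecutive vertices of the path are bases B_i, B_{i+1} = B_i - a + b with
   a outside S and b in S: if l defines the edge and a has minimal l-weight in
   the symmetric difference, exchanging a produces another l-maximal basis,
   which lies on the edge and so is the other endpoint. Hence elements of S only
   enter and elements outside S only leave along the path. Take w = sum_j e_{B_j}.
   For l_i = w + (2i + 1 - m) 1_S, the elements of both B_i and B_{i+1} have
   weight > i + 1, those of neither have weight < i + 1, and a, b have weight
   exactly i + 1; so l_i is maximal on B_M exactly on the segment from e_{B_i}
   to e_{B_{i+1}}, which is coherence. *)
Require Import Defs.
From mathcomp Require Import all_boot all_order all_algebra.
From mathcomp Require Import boolp classical_sets reals.
From mathcomp Require Import zify ring lra.

Set Implicit Arguments.
Unset Strict Implicit.
Unset Printing Implicit Defensive.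

Import Order.TTheory GRing.Theory Num.Theory.

Local Open Scope classical_set_scope.
Local Open Scope ring_scope.

(** * Linear functionals, segments and indicator vectors *)

Lemma dot_sum (R : realType) (E : finType) (c : vec R E) (n : nat)
    (t : 'I_n -> R) (p : 'I_n -> vec R E) :
  dot c (\sum_i t i *: p i) = \sum_i t i * dot c (p i).
Proof.
rewrite /dot; under eq_bigr => e _ do rewrite sum_ffunE mulr_sumr.
rewrite exchange_big; apply: eq_bigr => i _; rewrite mulr_sumr.
by apply: eq_bigr => e _; rewrite ffunE mulrCA.
Qed.

Lemma dot_seg (R : realType) (E : finType) (c u v : vec R E) (t : R) :
  dot c ((1 - t) *: u + t *: v) = (1 - t) * dot c u + t * dot c v.
Proof.
rewrite /dot !mulr_sumr -big_split; apply: eq_bigr => e _ /=.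
by rewrite !ffunE mulrDr mulrCA [c e * (t *: _)]mulrCA.
Qed.

Lemma dotDZl (R : realType) (E : finType) (w c x : vec R E) (k : R) :
  dot (w + k *: c) x = dot w x + k * dot c x.
Proof.
rewrite /dot mulr_sumr -big_split; apply: eq_bigr => e _ /=.
by rewrite !ffunE mulrDl -mulrA.
Qed.

Lemma seg_src (R : realType) (E : finType) (u v : vec R E) : seg u v u.
Proof. by exists 0; rewrite lexx ler01 subr0 scale1r scale0r addr0. Qed.

Lemma seg_tgt (R : realType) (E : finType) (u v : vec R E) : seg u v v.
Proof. by exists 1; rewrite lexx ler01 subrr scale1r scale0r add0r. Qed.

Lemma indic_inj (R : realType) (E : finType) :
  injective (@indic R E).
Proof.
move=> A B /ffunP AB; apply/setP => e; have := AB e; rewrite !indicE.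
by case: (e \in A); case: (e \in B) => // /eqP; rewrite ?oner_eq0 // eq_sym oner_eq0.
Qed.

Lemma dot_exchange (R : realType) (E : finType) (l : vec R E) (A : {set E})
    (a b : E) :
  a \in A -> b \notin A ->
  dot l (indic R (b |: (A :\ a))) = dot l (indic R A) - l a + l b.
Proof.
move=> aA bA.
have split_ind (B : {set E}) (e : E) : e \in B -> \sum_i l i * indic R B i =
    l e + \sum_i l i * indic R (B :\ e) i.
  move=> eB; rewrite (bigD1 e) //= [in RHS](bigD1 e) //=.
  rewrite !indicE eB !inE eqxx mulr1 mulr0 add0r; congr (_ + _).
  by apply: eq_bigr => i ie; rewrite !indicE !inE ie.
rewrite /dot (split_ind (b |: _) b) ?finset.setU11 // (split_ind A a) //.
rewrite finset.setU1K ?inE ?(negbTE bA) ?andbF //.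
by rewrite [l a + _]addrC addrK addrC.
Qed.

(** If every [p i] fell strictly below the mean, the weighted gaps, which are nonnegative and sum to
    zero, would force every [t i] to vanish. *)
Lemma dot_mean_le (R : realType) (E : finType) (l : vec R E) (n : nat)
    (t : 'I_n -> R) (p : 'I_n -> vec R E) :
  (forall i, 0 <= t i) -> \sum_i t i = 1 ->
  exists i, dot l (\sum_i t i *: p i) <= dot l (p i).
Proof.
move=> t0 t1; apply: contrapT => /forallNP H.
have lt_p i : dot l (p i) < dot l (\sum_i t i *: p i).
  by rewrite ltNge; apply/negP/H.
set s := dot l _ in lt_p.
suff /eqP : \sum_i t i = 0 by rewrite t1 oner_eq0.
have tz i : 0 <= t i * (s - dot l (p i)).
  by rewrite mulr_ge0 // subr_ge0 ltW.
have : \sum_i t i * (s - dot l (p i)) == 0.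
  under eq_bigr => i _ do rewrite mulrBr.
  by rewrite sumrB -mulr_suml t1 mul1r -dot_sum subrr.
rewrite psumr_eq0 // => /allP z; apply: big1 => i _.
have := z i (mem_index_enum _); rewrite mulf_eq0 subr_eq0 => /orP[/eqP //|].
by rewrite gt_eqF.
Qed.

(** * Bases, vertices and edges of the base polytope *)

Lemma base_polytope_basis (R : realType) (E : finType) (M : matroid E)
    (B : {set E}) :
  B \in bases M -> base_polytope R M (indic R B).
Proof.
move=> BM; exists 1%N, (fun=> 1), (fun=> indic R B); split=> [_|||] //.
- by rewrite big_ord1.
- by move=> _; exists B.
- by rewrite big_ord1 scale1r.
Qed.

(** Induction on the size of [A :\: B]: an exchange keeps the cardinality of [A] and shrinks this
    difference. Once [A] is contained in [B], an element of [B :\: A] would have no exchange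
    partner. *)
Lemma bases_card (E : finType) (M : matroid E) (A B : {set E}) :
  A \in bases M -> B \in bases M -> #|A| = #|B|.
Proof.
have [n] := ubnP #|A :\: B|; elim: n A => // n IHn A ltn AM BM.
have [/eqP|[a aAB]] := set_0Vmem (A :\: B).
  rewrite finset.setD_eq0 => sAB; have [/eqP|[b bBA]] := set_0Vmem (B :\: A).
    by rewrite finset.setD_eq0 => sBA; congr #|pred_of_set _|; apply/eqP; rewrite finset.eqEsubset sAB.
  have [a] := basis_exchange BM AM bBA.
  by rewrite inE => /andP[aB /(fintype.subsetP sAB)]; rewrite (negbTE aB).
have [b bBA A'M] := basis_exchange AM BM aAB.
move: (aAB) (bBA); rewrite !inE => /andP[aB aA] /andP[bA bB].
rewrite -(IHn _ _ A'M BM).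
  by rewrite cardsU1 !inE (negbTE bA) andbF [LHS](cardsD1 a) aA.
rewrite (cardsD1 a) aAB add1n ltnS in ltn; apply: leq_ltn_trans ltn.
apply: subset_leq_card; apply/fintype.subsetP => e; rewrite !inE.
by case: eqP => [->|_] /=; [rewrite bB | case/and3P => -> -> ->].
Qed.

Lemma sum_indic (R : realType) (E : finType) (A : {set E}) :
  \sum_e indic R A e = #|A|%:R.
Proof.
under eq_bigr => e _ do rewrite indicE.
by rewrite -natr_sum -sum1_card [in RHS]big_mkcond; congr _%:R; apply: eq_bigr.
Qed.

(** The hypersimplex constraints are the information about points of $B_M$ that [exchange_face]
    takes as input. *)
Lemma base_polytope_hypersimplex (R : realType) (E : finType) (M : matroid E)
    (B : {set E}) (x : vec R E) :
  B \in bases M -> base_polytope R M x ->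
  (forall e, 0 <= (x e : R) <= 1) /\ \sum_e (x e : R) = #|B|%:R.
Proof.
move=> BM [n [t [p [t0 t1 pM ->]]]]; split=> [e|].
  have p01 i : 0 <= (p i e : R) <= 1.
    by have [C _ ->] := pM i; rewrite indicE; case: (e \in C); rewrite ?lexx ?ler01.
  rewrite sum_ffunE -t1; apply/andP; split.
    apply: sumr_ge0 => i _; rewrite ffunE; apply: mulr_ge0 => //.
    by case/andP: (p01 i).
  apply: ler_sum => i _; rewrite ffunE; apply: ler_piMr => //.
  by case/andP: (p01 i).
under eq_bigr => e _ do rewrite sum_ffunE.
rewrite exchange_big /=.
transitivity (\sum_i t i * #|B|%:R); last by rewrite -mulr_suml t1 mul1r.
apply: eq_bigr => i _; have [C CM ->] := pM i.
rewrite (bases_card BM CM) -sum_indic mulr_sumr.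
by apply: eq_bigr => e _; rewrite ffunE.
Qed.

(** Some generator has [l]-value at least that of [v], so it lies in the one-point face
    [[set v]]. *)
Lemma vertex_basis (R : realType) (E : finType) (M : matroid E) (v : vec R E) :
  is_vertex (base_polytope R M) v ->
  exists2 B, B \in bases M & v = indic R B.
Proof.
case=> l lv; have [[n [t [p [t0 t1 pM def_v]]]] v_max] : max_face (base_polytope R M) l v.
  by rewrite lv.
have [i le_i] := dot_mean_le l p t0 t1; rewrite -def_v in le_i.
have [B BM pB] := pM i; exists B => //.
suff : max_face (base_polytope R M) l (p i) by rewrite lv pB => <-.
rewrite pB; split; first exact: base_polytope_basis.
by move=> y /v_max /le_trans; apply; rewrite -pB.
Qed.

Lemma edge_exchange (R : realType) (E : finType) (M : matroid E)
    (A B : {set E}) :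
  A \in bases M -> B \in bases M ->
  is_edge (base_polytope R M) (indic R A) (indic R B) ->
  exists a b, [/\ a \in A, b \notin A & B = b |: (A :\ a)].
Proof.
move=> AM BM [neAB [l l_face]].
pose F := max_face (base_polytope R M) l.
have FA : F (indic R A) by rewrite /F l_face; apply: seg_src.
have FB : F (indic R B) by rewrite /F l_face; apply: seg_tgt.
(* Replacing [a] by an element of at least the same [l]-weight cannot lower [l], so the new basis
   stays in the face. *)
have swap C D a : C \in bases M -> D \in bases M -> F (indic R C) ->
    a \in C :\: D ->
    (forall e, e \in D :\: C -> l a <= l e) ->
    exists2 b, b \in D :\: C & F (indic R (b |: (C :\ a))).
  move=> CM DM [_ C_max] aCD a_min; have [b bDC C'M] := basis_exchange CM DM aCD.
  exists b => //; split; first exact: base_polytope_basis.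
  move=> y /C_max /le_trans; apply.
  move: (aCD) (bDC); rewrite !inE => /andP[_ aC] /andP[bC _].
  rewrite dot_exchange //.
  by have := a_min b bDC; lra.
(* At parameter [t] the coordinate at [a] equals $1-t$, so a point whose coordinate there is zero
   must be the endpoint [v]. *)
have seg_end (C : {set E}) a (u v : {set E}) : seg (indic R u) (indic R v) (indic R C) ->
    a \in u -> a \notin v -> a \notin C -> C = v.
  case=> t [_ def_C] au av aC; apply: (@indic_inj R); rewrite def_C.
  have -> : t = 1; last by rewrite subrr scale0r scale1r add0r.
  move/ffunP/(_ a): def_C; rewrite !ffunE !indicE au (negbTE av) (negbTE aC).
  rewrite /GRing.scale /= mulr1 mulr0 addr0 => /esym/eqP.
  by rewrite subr_eq0 => /eqP.
have segC u v : seg (indic R u) (indic R v) `<=` seg (indic R v) (indic R u).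
  move=> x [t [/andP[t0 t1] ->]]; exists (1 - t); split; first lra.
  by rewrite subKr addrC.
have [a0 a0D] : exists a, a \in (A :\: B) :|: (B :\: A).
  have [D0|[a ?]] := set_0Vmem ((A :\: B) :|: (B :\: A)); last by exists a.
  case: neAB; congr (indic R _); apply/setP => e; move/setP/(_ e): D0; rewrite !inE.
  by case: (e \in A); case: (e \in B).
have [a aD a_min] : exists2 a, a \in (A :\: B) :|: (B :\: A) &
    forall e, e \in (A :\: B) :|: (B :\: A) -> l a <= l e.
  by case: (arg_minP (fun e => l e : R) a0D) => a; exists a.
move: (aD); rewrite inE => /orP[aAB|aBA].
  have [|b bBA] := swap A B a AM BM FA aAB.
    by move=> e eBA; apply: a_min; rewrite inE eBA orbT.
  move: aAB bBA; rewrite !inE => /andP[aB aA] /andP[bA bB].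
  rewrite /F l_face => /seg_end/(_ aA aB) defB; exists a, b; split=> //.
  by rewrite defB // !inE eqxx orbF; apply: contraNneq aB => ->.
(* With [a] in [B], the exchange yields [A] from [B]. Reading it backwards swaps the roles of [a]
   and [b] in the witnesses. *)
have [|b bAB] := swap B A a BM AM FB aBA.
  by move=> e eAB; apply: a_min; rewrite inE eAB.
move: aBA bAB; rewrite !inE => /andP[aA aB] /andP[bB bA].
rewrite /F l_face => /segC/seg_end/(_ aB aA) defA; exists b, a; split=> //.
rewrite -defA; last first.
  by rewrite !inE eqxx orbF; apply: contraNneq aA => ->.
rewrite finset.setU1K ?finset.setD1K // !inE (negbTE bB) andbF //.
Qed.

(** * Optimality of an exchange segment and a criterion for coherence *)

(** Since [x] and [A] have the same coordinate sum, [l] may be replaced by $l-k$. Then each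
    coordinate contributes a nonnegative amount [d e] to the gap. A zero gap makes [x] agree with
    [A] away from [a] and [b], and the fixed sum leaves one free parameter, [x b]. *)
Lemma exchange_face (R : realType) (E : finType) (l x : vec R E) (k : R)
    (A : {set E}) (a b : E) :
  a \in A -> b \notin A -> l a = k -> l b = k ->
  (forall e, e \in A -> e != a -> k < l e) ->
  (forall e, e \notin A -> e != b -> l e < k) ->
  (forall e, 0 <= (x e : R) <= 1) -> \sum_e (x e : R) = #|A|%:R ->
  dot l x <= dot l (indic R A) /\
  (dot l x = dot l (indic R A) ->
   seg (indic R A) (indic R (b |: (A :\ a))) x).
Proof.
move=> aA bA la lb gtk ltk x01 sumx.
pose d (e : E) : R := (l e - k) * (indic R A e - x e).
have d_ge0 e : 0 <= d e.
  rewrite /d indicE; have /andP[x0 x1] := x01 e.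
  have [->|nea] := eqVneq e a; first by rewrite la subrr mul0r.
  have [->|neb] := eqVneq e b; first by rewrite lb subrr mul0r.
  case: (boolP (e \in A)) => eA /=.
    by apply: mulr_ge0; rewrite subr_ge0 // ltW // gtk.
  by apply: mulr_le0; rewrite ?sub0r ?oppr_le0 // subr_le0 ltW // ltk.
have sumd : \sum_e d e = dot l (indic R A) - dot l x.
  rewrite /d; under eq_bigr => e _ do rewrite mulrBl.
  rewrite sumrB -mulr_sumr sumrB sum_indic sumx subrr mulr0 subr0.
  by under eq_bigr => e _ do rewrite mulrBr; rewrite sumrB.
split; first by rewrite -subr_ge0 -sumd sumr_ge0.
move=> eq_dot.
have d0 e : d e = 0.
  move/eqP: sumd; rewrite eq_dot subrr psumr_eq0 // => /allP/(_ e).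
  by move=> /(_ (mem_index_enum _))/eqP.
have x_off e : e != a -> e != b -> x e = indic R A e.
  move=> nea neb; have /eqP := d0 e; rewrite mulf_eq0 !subr_eq0.
  case: (boolP (e \in A)) => eA.
    by rewrite gt_eqF ?gtk //= => /eqP.
  by rewrite lt_eqF ?ltk //= => /eqP.
have neba : b != a by apply: contraNneq bA => ->.
have xab : x a = 1 - x b :> R.
  move: sumx; rewrite -sum_indic (bigD1 a) //= (bigD1 b) //=.
  rewrite [X in _ = X](bigD1 a) //= [X in _ = _ + X](bigD1 b) //=.
  rewrite !indicE aA (negbTE bA) add0r addrA.
  rewrite (eq_bigr (fun e => indic R A e)); last by move=> e /andP[]; apply: x_off.
  by move/addIr/(canRL (addrK _)).
exists (x b); split; first exact: x01.
apply/ffunP => e; rewrite !ffunE !indicE !inE /GRing.scale /=.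
have [->|nea] := eqVneq e a.
  by rewrite eq_sym (negbTE neba) aA /= mulr1 mulr0 addr0.
have [->|neb] := eqVneq e b; first by rewrite (negbTE bA) /= mulr0 mulr1 add0r.
by rewrite x_off // indicE /= -mulrDl subrK mul1r.
Qed.

Lemma exists_step_between (R : realType) (f : nat -> R) (m : nat) (s : R) :
  (0 < m)%N -> f 0%N <= s <= f m -> exists2 i, (i < m)%N & f i <= s <= f i.+1.
Proof.
elim: m => // m IHm _ /andP[s0 sm].
have [le_s|lt_s] := leP s (f m); last by exists m => //; rewrite sm ltW.
case: m IHm sm le_s => [|m] IHm sm le_s; first by exists 0%N => //; rewrite s0.
by have [|i im fi] := IHm isT; [rewrite s0 | exists i => //; apply: ltnW].
Qed.

(** On a fibre of [c], maximizing [w + k *: c] amounts to maximizing [w]; hence each step projects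
    to a piece of the upper boundary, of slope $-k$. The steps together cover the whole range of
    [c]. *)
Lemma coherent_of_faces (R : realType) (E : finType) (P : set (vec R E))
    (c w : vec R E) (m : nat) (v : 'I_m.+1 -> vec R E) :
  (0 < m)%N ->
  (forall x, P x -> dot c (v ord0) <= dot c x <= dot c (v ord_max)) ->
  (forall i : 'I_m, dot c (step_src v i) < dot c (step_tgt v i)) ->
  (forall i : 'I_m, exists k, max_face P (w + k *: c) = step_seg v i) ->
  coherent P c v.
Proof.
move=> m0 c_bounds c_incr faces; exists w.
have P_seg i x : step_seg v i x -> P x by have [k <-] := faces i; case.
split=> [|i]; apply/seteqP; split.
- move=> _ [[x Px <-] x_top].
  have [i im] : exists2 i, (i < m)%N &
      dot c (v (inord i)) <= dot c x <= dot c (v (inord i.+1)).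
    apply: (exists_step_between (f := fun i => dot c (v (inord i)))) => //.
    have -> : inord 0 = ord0 :> 'I_m.+1 by apply: val_inj; rewrite /= inordK.
    have -> : inord m = ord_max :> 'I_m.+1 by apply: val_inj; rewrite /= inordK.
    exact: c_bounds.
  pose j := Ordinal im; have := c_incr j; rewrite /step_src /step_tgt /=.
  set p := dot c (v (inord i)); set q := dot c (v (inord i.+1)) => pq /andP[px xq].
  (* This parameter puts [y] on the segment with the same [c]-value as [x]. *)
  pose t := (dot c x - p) / (q - p).
  pose y := (1 - t) *: v (inord i) + t *: v (inord i.+1).
  have qp0 : 0 < q - p by rewrite subr_gt0.
  have yseg : step_seg v j y.
    exists t; split=> //; rewrite /t divr_ge0 ?subr_ge0 ?(ltW pq) //=.
    by rewrite ler_pdivrMr // mul1r lerD2r.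
  have cy : dot c y = dot c x.
    rewrite dot_seg -/p -/q /t; field; by rewrite gt_eqF.
  exists j => //; exists y => //; rewrite /proj cy; congr pair.
  have [k face] := faces j; have : max_face P (w + k *: c) y by rewrite face.
  case=> Py /(_ x Px); rewrite !dotDZl cy lerD2r le_eqVlt => /orP[/eqP//|lt_w].
  (* Otherwise [y] projects strictly above [x], contradicting that [x] is on the upper boundary. *)
  have [] := x_top (dot w y - dot w x); first by rewrite subr_gt0.
  by exists y => //; rewrite /proj cy /= addrC subrK.
- move=> _ [i _ [x xseg <-]]; split; first by exists x => //; apply: P_seg xseg.
  move=> eps eps0 [y Py [cy wy]].
  have [k face] := faces i; have : max_face P (w + k *: c) x by rewrite face.
  by case=> Px /(_ y Py); rewrite !dotDZl cy wy lerD2r gerDl leNgt eps0.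
- move=> x [Px [y yseg [cy wy]]].
  have [k face] := faces i; have : max_face P (w + k *: c) y by rewrite face.
  rewrite -face => -[Py y_max]; split=> // z /y_max.
  by rewrite !dotDZl cy wy.
- by move=> x xseg; split; [apply: P_seg xseg | exists x].
Qed.

(** * Membership counts along a path of exchanges *)

Lemma sum_leq_ord (n k : nat) : (\sum_(j < n) (k <= j) = n - k)%N.
Proof. by elim: n => [|n IHn]; rewrite ?big_ord0 ?big_ord_recr /= ?IHn; lia. Qed.

Lemma sum_ltn_ord (n k : nat) : (\sum_(j < n) (j < k) = minn n k)%N.
Proof. by elim: n => [|n IHn]; rewrite ?big_ord0 ?big_ord_recr /= ?IHn; lia. Qed.

Section ExchangePath.

Variables (E : finType) (S : {set E}) (m : nat) (B : nat -> {set E}).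

Hypothesis stepB : forall i, (i < m)%N -> exists a b,
  [/\ a \in B i :\: S, b \in S :\: B i & B i.+1 = b |: (B i :\ a)].

(** Each step discards only an element outside [S]. Dually, [out_mono] holds because each step adds
    only an element of [S]. *)
Lemma in_mono (e : E) (i j : nat) :
  e \in S -> (i <= j <= m)%N -> e \in B i -> e \in B j.
Proof.
move=> eS /andP[]; elim: j => [|j IHj]; first by rewrite leqn0 => /eqP->.
rewrite leq_eqVlt => /orP[/eqP-> //|]; rewrite ltnS => ij jm /(IHj ij (ltnW jm)) eB.
have [a [b [aB _ ->]]] := stepB jm; rewrite !inE eB andbT.
by apply/orP; right; apply: contraTneq aB => <-; rewrite inE eS.
Qed.

Lemma out_mono (e : E) (i j : nat) :
  e \notin S -> (i <= j <= m)%N -> e \in B j -> e \in B i.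
Proof.
move=> eS /andP[]; elim: j => [|j IHj]; first by rewrite leqn0 => /eqP->.
rewrite leq_eqVlt => /orP[/eqP-> //|]; rewrite ltnS => ij jm.
have [a [b [_ bS ->]]] := stepB jm; rewrite !inE => /orP[/eqP eb|/andP[_ eB]].
  by move: bS; rewrite -eb inE (negbTE eS) andbF.
exact: IHj ij (ltnW jm) eB.
Qed.

(** The coordinate at [e] of the vector $w=\sum_j e_{B_j}$. *)
Let N (e : E) : nat := \sum_(j < m.+1) (e \in B j).

(** By monotonicity, the indices [j] with [e] in [B j] form a final interval of $0,\dots,m$ for [e]
    in [S] and an initial one otherwise. The four bounds count which part of the range membership at
    [i] includes or excludes. *)
Lemma in_count_ge (e : E) (i : nat) :
  (i <= m)%N -> e \in S -> e \in B i -> (m.+1 - i <= N e)%N.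
Proof.
move=> im eS eB; rewrite -sum_leq_ord; apply: leq_sum => j _.
case: (leqP i j) => //= ij; rewrite (in_mono eS _ eB) // ij -ltnS ltn_ord //.
Qed.

Lemma in_count_le (e : E) (i : nat) :
  (i <= m)%N -> e \in S -> e \notin B i -> (N e <= m - i)%N.
Proof.
move=> im eS eB; rewrite -subSS -sum_leq_ord; apply: leq_sum => j _.
case: (leqP i.+1 j) => //= ji; first by case: (_ \in _).
rewrite leqn0 eqb0; apply: contra eB; apply: in_mono => //; move: ji; rewrite im andbT; lia.
Qed.

Lemma out_count_ge (e : E) (i : nat) :
  (i <= m)%N -> e \notin S -> e \in B i -> (i.+1 <= N e)%N.
Proof.
move=> im eS eB; have -> : i.+1 = minn m.+1 i.+1 by lia.
rewrite -sum_ltn_ord; apply: leq_sum => j _.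
by case: (ltnP j i.+1) => //= ji; rewrite (out_mono eS _ eB) // im andbT.
Qed.

Lemma out_count_le (e : E) (i : nat) :
  (i <= m)%N -> e \notin S -> e \notin B i -> (N e <= i)%N.
Proof.
move=> im eS eB; have -> : i = minn m.+1 i by lia.
rewrite -sum_ltn_ord; apply: leq_sum => j _.
case: (ltnP j i) => //= ij; first by case: (_ \in _).
rewrite leqn0 eqb0; apply: contra eB; apply: out_mono => //.
by rewrite ij -ltnS ltn_ord.
Qed.

(** Here [a] lies in exactly $B_0,\dots,B_i$ and [b] in exactly $B_{i+1},\dots,B_m$, so $N(a)=i+1$
    and $N(b)=m-i$. The coefficient $2i+1-m$ of [indic R S] is the difference that equalizes their
    weights. *)
Lemma exchange_path_weights (R : realType) (i : nat) (a b : E)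
    (l := \sum_(j < m.+1) indic R (B j) + (i.*2.+1%:R - m%:R) *: indic R S) :
  (i < m)%N -> a \in B i :\: S -> b \in S :\: B i ->
  B i.+1 = b |: (B i :\ a) ->
  [/\ l a = i.+1%:R, l b = i.+1%:R,
      forall e, e \in B i -> e != a -> i.+1%:R < (l e : R)
    & forall e, e \notin B i -> e != b -> (l e : R) < i.+1%:R].
Proof.
move=> im; rewrite !inE => /andP[aS aB] /andP[bB bS] defB.
have im' := ltnW im.
have lE e : l e = (N e)%:R + (i.*2.+1%:R - m%:R) * (e \in S)%:R.
  rewrite /l !ffunE indicE sum_ffunE natr_sum; congr (_ + _).
  by apply: eq_bigr => j _; rewrite indicE.
have aB' : a \notin B i.+1.
  by rewrite defB !inE eqxx orbF; apply: contraTneq bS => <-.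
have bB' : b \in B i.+1 by rewrite defB finset.setU11.
split.
- rewrite lE (negbTE aS) mulr0 addr0; congr _%:R; apply/eqP; rewrite eqn_leq.
  by rewrite (out_count_le im aS aB') (out_count_ge im' aS aB).
- have -> : l b = (N b + i.*2.+1)%:R - m%:R :> R.
    by rewrite lE bS mulr1 natrD addrA.
  apply/eqP; rewrite subr_eq -natrD eqr_nat.
  by have := in_count_le im' bS bB; have := in_count_ge im bS bB'; lia.
- move=> e eB nea; rewrite lE; have [eS|eS] := boolP (e \in S).
    rewrite mulr1 addrA ltrBrDr -!natrD ltr_nat.
    by have := in_count_ge im' eS eB; lia.
  (* Being different from [a], the element survives into [B i.+1]; applying the bound there gives a
     count of at least $i+2$. *)
  rewrite mulr0 addr0 ltr_nat; apply: out_count_ge => //.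
  by rewrite defB !inE nea eB orbT.
- move=> e eB neb; rewrite lE; have [eS|eS] := boolP (e \in S).
    rewrite mulr1 addrA ltrBlDr -!natrD ltr_nat.
    (* Being different from [b], the element is also missing from [B i.+1], which improves the bound
       on its count to $m-i-1$. *)
    have eB' : e \notin B i.+1 by rewrite defB !inE negb_or neb (negbTE eB) andbF.
    by have := in_count_le im eS eB'; lia.
  by rewrite mulr0 addr0 ltr_nat ltnS; apply: out_count_le.
Qed.

End ExchangePath.

(** * Monotone paths on the base polytope *)

Theorem theorem8p1 (R : realType) (E : finType) (M : matroid E) (S : {set E})
    (m : nat) (v : 'I_m.+1 -> vec R E) :
  monotone_path (base_polytope R M) (indic R S) v ->
  coherent (base_polytope R M) (indic R S) v.
Proof.
move=> [[x0 [y0 [Px0 Py0 neq_xy]]] [vert [_ v_min] [_ v_max] edges incr]].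
have m0 : (0 < m)%N.
  (* For $m=0$ the single vertex both minimizes and maximizes the functional, which would then be
     constant. *)
  case: m v v_min v_max {vert edges incr} => // v v_min v_max; case: neq_xy.
  have same : ord0 = ord_max :> 'I_1 by apply: val_inj.
  rewrite -same in v_max; apply: le_anti.
  by rewrite (le_trans (v_max _ Px0)) ?v_min // (le_trans (v_max _ Py0)) ?v_min.
(* Beyond [m], [inord j] defaults to [ord0], so [B] is total on the natural numbers. *)
have [B BM vB] : exists2 B : nat -> {set E}, forall j, B j \in bases M &
    forall j, v (inord j) = indic R (B j).
  have /choice[B BP] j : exists B, B \in bases M /\ v (inord j) = indic R B.
    by have [B ? ?] := vertex_basis (vert (inord j)); exists B.
  by exists B => j; case: (BP j).
have stepB i : (i < m)%N -> exists a b,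
    [/\ a \in B i :\: S, b \in S :\: B i & B i.+1 = b |: (B i :\ a)].
  move=> im; have := incr (Ordinal im); have := edges (Ordinal im).
  rewrite /step_src /step_tgt /= !vB => /edge_exchange.
  case=> // a [b [aB bB defB]]; rewrite defB dot_exchange // !indicE => lt_ab.
  (* The exchange changes the functional by $[b\in S]-[a\in S]$, which is positive only for [a]
     outside [S] and [b] in [S]. *)
  exists a, b; split=> //; rewrite !inE ?aB ?bB ?andbT /=.
    by apply: contraTN lt_ab => ->; case: (b \in S); rewrite -leNgt ?subrK ?addr0 ?gerBl ?ler01.
  by apply: contraLR lt_ab => /negbTE->; case: (a \in S); rewrite -leNgt addr0 ?subr0 ?gerBl ?ler01.
apply: (@coherent_of_faces _ _ _ _ (\sum_(j < m.+1) indic R (B j))) => //.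
  by move=> x Px; rewrite v_min // v_max.
case=> i im; exists (i.*2.+1%:R - m%:R); set l := _ + _.
rewrite /step_seg /step_src /step_tgt /= !vB.
have [a [b [aBS bSB defB]]] := stepB i im.
have [la lb gtl ltl] := exchange_path_weights stepB R im aBS bSB defB.
move: aBS bSB; rewrite !inE => /andP[_ aB] /andP[bB _].
have face x : base_polytope R M x -> _ :=
  fun Px => let: conj x01 sumx := base_polytope_hypersimplex (BM i) Px in
  exchange_face aB bB la lb gtl ltl x01 sumx.
have PB j : base_polytope R M (indic R (B j)) by apply: base_polytope_basis.
rewrite defB; apply/seteqP; split=> x.
  move=> [Px x_max]; have [le_x] := face x Px; apply.
  by apply: le_anti; rewrite le_x x_max.
(* The segment lies in the polytope because it is a face, by the edge condition on the path. *)
have seg_P : seg (indic R (B i)) (indic R (B i.+1)) `<=` base_polytope R M.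
  have [_ [l' face']] := edges (Ordinal im).
  by move: face'; rewrite /step_src /step_tgt /= !vB => <- z [].
move=> xseg; split; first by apply: seg_P; rewrite defB.
move=> y /face[le_y _]; apply: le_trans le_y _.
(* As [l a = l b], both endpoints have the same [l]-value and [l] is constant on the segment. *)
case: xseg => t [_ ->]; rewrite dot_seg dot_exchange // la lb subrK.
by rewrite -mulrDl subrK mul1r.
Qed.
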